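(* Let $f:\Pi\to\overline{\Pi}$ be analytic and let $\tau\in\mathbb{R}$ belong to the cryptospectrum of $f$. Let $\lambda:\mathbb{R}^+\to\mathbb{R}^+$ be $\Omega(t)$ as $t\to0$. Then there exists $\mathfrak{k}:\mathbb{R}^+\to\mathbb{R}^+$ which is $o(1)$ as $t\to0$ such that $\tau\in\mathfrak{E}^{\mathfrak{k}}_{f,\lambda}$.
   Context: $\Pi$ is the open upper half plane in $\mathbb{C}$, $\overline{\Pi}=\{z\in\mathbb{C}:\operatorname{Im}z\ge0\}$, and $\mathbb{R}^+=(0,\infty)$. For analytic $f:\Pi\to\overline{\Pi}$ and $\mathfrak{k}:\mathbb{R}^+\to\mathbb{R}^+$ put $\mathfrak{F}^{\mathfrak{k}}_f(z)=\operatorname{Im}f(z)/\mathfrak{k}(\operatorname{Im}z)$ (so $\mathfrak{F}^{1}_f=\operatorname{Im}f$) and, for $\lambda:\mathbb{R}^+\to\mathbb{R}^+$, $\tau\in\mathbb{R}$ and $\varepsilon>0$, $A\mathfrak{F}^{\mathfrak{k},\tau}_{f,\lambda}(\varepsilon)=\frac{1}{2\varepsilon}\int_{-\varepsilon}^{\varepsilon}\mathfrak{F}^{\mathfrak{k}}_f(\tau+x+i\lambda(\varepsilon))\,dx$. The $\mathfrak{k},\lambda$-enigma is $$\mathfrak{E}^{\mathfrak{k}}_{f,\lambda}=\Big\{\tau\in\mathbb{R}:\ \limsup_{\varepsilon\to0}A\mathfrak{F}^{\mathfrak{k},\tau}_{f,\lambda}(\varepsilon)<\infty\ \text{ or }\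 \limsup_{\varepsilon\to0}A\mathfrak{F}^{\mathfrak{k},\tau}_{-1/f,\lambda}(\varepsilon)<\infty\Big\}.$$ A set $S\subset\Pi$ is nontangential at $\tau$ if for some $0<M\le1$ it is contained in $\{z\in\Pi:\operatorname{Im}z\ge M|z-\tau|\}$; a nontangential limit at $\tau$ is a limit as $z\to\tau$ through each such region. The cryptospectrum of $f$ is the set of $\tau\in\mathbb{R}$ such that the nontangential limit of $\mathfrak{F}^1_f(z)=\operatorname{Im}f(z)$ at $\tau$ exists in $[0,\infty]$ and equals $0$ or $\infty$, and $\tau$ is neither a B-point nor a pole of $f$. Here $\tau$ is a B-point of $f$ if $\operatorname{Im}f(z_n)/\operatorname{Im}z_n$ is bounded for every sequence $z_n\in\Pi$ tending to $\tau$ nontangentially, and $\tau$ is a pole of $f$ if the nontangential limit of $(z-\tau)f(z)$ at $\tau$ is nonzero. ''$\lambda$ is $\Omega(t)$ as $t\to0$'' means there are $k,\delta>0$ with $\lambda(t)>kt$ for $0<t<\delta$; ''$\mathfrak{k}$ is $o(1)$ as $t\to0$'' means $\mathfrak{k}(t)\to0$ as $t\to0$. *)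

(* Defs.v *)
From HB Require Import structures.
From mathcomp Require Import all_boot all_order all_algebra.
From mathcomp Require Import all_classical all_reals all_analysis.
From mathcomp Require Export complex.

Set Implicit Arguments.
Unset Strict Implicit.
Unset Printing Implicit Defensive.

Import Order.TTheory GRing.Theory Num.Theory numFieldNormedType.Exports.

Local Open Scope classical_set_scope.
Local Open Scope ring_scope.
Local Open Scope complex_scope.

(* The complex plane is R[i]^o: the topology lives on the regular module R[i]^o,
   the bare type R[i] carries none.  A function on the upper half plane is a
   total function R[i]^o -> R[i]^o whose values elsewhere are never used; in the
   same way, k and lambda are only used on ]0, +oo[.  The unqualified name Im
   denotes the R[i]-valued imaginary part, hence complex.Im, with values in R. *)

Section Enigma.
Context {R : realType}.
Implicit Types (f : R[i]^o -> R[i]^o) (k lambda : R -> R) (tau : R).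

Definition upper_half_plane : set R[i]^o := [set z | 0 < complex.Im z].

Definition analytic_on (D : set R[i]^o) f : Prop :=
  forall z0, D z0 -> exists a : nat -> R[i]^o,
    \forall z \near z0, series (fun n => a n * (z - z0) ^+ n) @ \oo --> f z.

Definition frakF k f (z : R[i]^o) : R := complex.Im (f z) / k (complex.Im z).

Definition avg_frakF k f lambda tau (eps : R) : \bar R :=
  (((2 * eps)^-1)%:E *
   \int[lebesgue_measure]_(x in `[(- eps)%R, eps])
     (frakF k f ((tau + x)%R +i* lambda eps)%C)%:E)%E.

(* - 1 / f z is 0 at a zero z of f.  By the open mapping theorem, an analytic f
   from the open to the closed upper half plane has a zero only if it is
   identically 0. *)
Definition enigma k f lambda : set R :=
  [set tau |
     (limf_esup (avg_frakF k f lambda tau) 0^'+ < +oo)%E \/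
     (limf_esup (avg_frakF k (fun z => (- 1 / f z)%R) lambda tau) 0^'+ < +oo)%E].

(* The modulus on R[i] takes its values in R[i], whence the embedding of the
   real numbers on both sides of the inequality. *)
Definition nt_region (M tau : R) : set R[i]^o :=
  [set z | upper_half_plane z /\ M%:C * `|z - tau%:C| <= (complex.Im z)%:C].

Definition nontangential tau (S : set R[i]^o) : Prop :=
  exists M : R, [/\ 0 < M, M <= 1 & S `<=` nt_region M tau].

Definition nt_limit (T : topologicalType) (g : R[i]^o -> T) tau (l : T) : Prop :=
  forall M : R, 0 < M -> M <= 1 ->
    g @ within (nt_region M tau) (nbhs (tau%:C : R[i]^o)) --> l.

Definition B_point f tau : Prop :=
  forall u : nat -> R[i]^o, nontangential tau (range u) ->
    u @ \oo --> (tau%:C : R[i]^o) ->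
    bounded_fun (fun n => complex.Im (f (u n)) / complex.Im (u n) : R).

Definition pole f tau : Prop :=
  exists2 l : R[i]^o, l != 0 & nt_limit (fun z => (z - tau%:C) * f z) tau l.

(* The limit of F^1_f = Im f is taken in the extended reals, so that the value
   +oo is allowed. *)
Definition cryptospectrum f : set R :=
  [set tau |
     [/\ nt_limit (fun z => (frakF (fun=> 1) f z)%:E) tau 0%E \/
         nt_limit (fun z => (frakF (fun=> 1) f z)%:E) tau +oo%E,
         ~ B_point f tau & ~ pole f tau]].

Definition is_Omega_id lambda : Prop :=
  exists c delta : R, [/\ 0 < c, 0 < delta &
    forall t, 0 < t < delta -> c * t < lambda t].

End Enigma.

(* Main.v *)
Require Import Defs.
From HB Require Import structures.
From mathcomp Require Import all_boot all_order all_algebra.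
From mathcomp Require Import all_classical all_reals all_analysis.
From mathcomp Require Import measurable_realfun ring lra.

Set Implicit Arguments.
Unset Strict Implicit.
Unset Printing Implicit Defensive.

Import Order.TTheory GRing.Theory Num.Theory numFieldNormedType.Exports.

Local Open Scope classical_set_scope.
Local Open Scope ring_scope.
Local Open Scope complex_scope.
Import Normc.

(** Let [h] be [Im f] if [Im f] tends to [0] nontangentially at [tau], and
    [Im (- 1 / f)] if [Im f] tends to [+oo].  In both cases [h] is nonnegative on
    the half plane and tends to [0] nontangentially at [tau]; in the second case
    because [Im (- 1 / w) = Im w / |w| ^ 2 <= 1 / Im w].

    If [lambda t > c t] near [0], then for small [eps] the segment over which the
    average is taken, at height [y = lambda eps], lies in [|x - tau| <= y / c].
    These slices, over all heights [y > 0], form a nontangential set, so the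
    maximum [m y] of [h] on the slice at height [y] tends to [0] with [y].  The
    gauge [k y = m y + y] is positive, tends to [0] and dominates [h] on the
    slice, so all averages of [h / k] for small [eps] are at most [1]
    ([exists_gauge]).

    Since [lambda] is not assumed to tend to [0], slices at every height matter,
    and [m y] is finite only if [h] is continuous on the whole half plane.  For
    [Im f] this is the continuity of analytic functions.  For [Im (- 1 / f)] one
    needs in addition that [f] has no zero, which follows from the strong minimum
    principle: if [Im f] vanished at one point of the half plane it would vanish
    identically ([Im_eq0_propagates]), and could not tend to [+oo].  Both facts
    are read off the power series through one remainder estimate
    ([expansion_remainder]): locally, the first nonconstant term
    [a m * (z - z0) ^+ m] takes all directions, so [Im f] cannot have a local
    minimum unless [f] is constant near [z0]. *)

(** * The complex plane through the real-valued modulus *)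

Section ComplexTopology.
Context {R : realType}.
Implicit Types (z w : R[i]^o) (r e : R).

(** The modulus that defines the topology takes its values in [R[i]], whose order
    is only partial; this criterion and the next one allow all estimates to be
    made with radii and bounds in [R]. *)
Lemma nbhs_normcP z (P : set R[i]^o) :
  nbhs z P <-> exists2 r : R, 0 < r & forall w, normc (w - z) < r -> P w.
Proof.
split.
- case/(@nbhs_normP R[i] R[i]^o z P) => e /= e0 eP.
  move: (e0); rewrite ltcE /= => /andP[/eqP eI eR].
  exists (complex.Re e) => // w wz; apply: eP => /=.
  rewrite distrC ltcE; apply/andP; split; last exact: wz.
  by rewrite eI.
- case=> r r0 rP; apply/(@nbhs_normP R[i] R[i]^o z P); exists r%:C => /=; first by rewrite ltcR.
  by move=> w /=; rewrite distrC => wz; apply: rP; rewrite -ltcR.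
Qed.

Lemma cvg_normcP T (F : set_system T) (FF : Filter F) (u : T -> R[i]^o) z :
  u @ F --> z <->
  forall e : R, 0 < e -> \forall t \near F, normc (u t - z) < e.
Proof.
split=> [/cvgrPdistC_lt uz e e0|uz].
  have := uz e%:C; rewrite ltcR => /(_ e0); apply: filterS => t.
  by rewrite -ltcR.
move=> P /nbhs_normcP[r r0 rP]; apply: (filterS _ (uz r r0)) => t; exact: rP.
Qed.

Lemma normc_ge0 z : 0 <= normc z.
Proof. by case: z => a b; exact: sqrtr_ge0. Qed.

Lemma ler_normcD z w : normc (z + w) <= normc z + normc w.
Proof. exact: (@le_normcD R). Qed.

Lemma normc_opp z : normc (- z) = normc z.
Proof. exact: (@normcN R). Qed.

Lemma normcX z n : normc (z ^+ n) = normc z ^+ n.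
Proof.
elim: n => [|n IH]; first by rewrite !expr0; exact: (@normc1 R).
by rewrite !exprS -IH; exact: normcM.
Qed.

Lemma normc_real r : normc (r%:C : R[i]^o) = `|r|.
Proof. by rewrite /= expr0n addr0 sqrtr_sqr. Qed.

Lemma ler_normc_Im z : `|complex.Im z| <= normc z.
Proof.
case: z => a b /=; rewrite -(sqrtr_sqr b) ler_wsqrtr// lerDr; exact: sqr_ge0.
Qed.

Lemma ler_normc_Re z : `|complex.Re z| <= normc z.
Proof.
case: z => a b /=; rewrite -(sqrtr_sqr a) ler_wsqrtr// lerDl; exact: sqr_ge0.
Qed.

Lemma normc_le_ReIm z : normc z <= `|complex.Re z| + `|complex.Im z|.
Proof.
case: z => a b /=; rewrite -[leRHS]ger0_norm ?addr_ge0 ?normr_ge0//.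
rewrite -sqrtr_sqr ler_wsqrtr// sqrrD !real_normK ?num_real//.
by rewrite addrAC lerDl mulrn_wge0 ?mulr_ge0.
Qed.

Lemma continuous_Im : continuous (fun z : R[i]^o => complex.Im z : R).
Proof.
move=> z; apply/(@cvgrPdistC_lt R R _ (nbhs z)) => e e0; apply/nbhs_normcP; exists e => // w.
apply: le_lt_trans; rewrite -raddfB; exact: ler_normc_Im.
Qed.

Lemma continuous_Re : continuous (fun z : R[i]^o => complex.Re z : R).
Proof.
move=> z; apply/(@cvgrPdistC_lt R R _ (nbhs z)) => e e0; apply/nbhs_normcP; exists e => // w.
apply: le_lt_trans; rewrite -raddfB; exact: ler_normc_Re.
Qed.

Lemma continuous_complex (x y : R -> R) t :
  {for t, continuous x} -> {for t, continuous y} ->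
  {for t, continuous (fun t => (x t +i* y t)%C : R[i]^o)}.
Proof.
move=> cx cy; apply/cvg_normcP => e e0.
have e2 : 0 < e / 2 by rewrite divr_gt0.
move/cvgrPdistC_lt: cx => /(_ _ e2) cx; move/cvgrPdistC_lt: cy => /(_ _ e2) cy.
apply: filterS2 cx cy => s sx sy.
apply: le_lt_trans (normc_le_ReIm _) _.
by rewrite [e]splitr; exact: ltrD.
Qed.

Lemma nbhs_upper_half_plane z :
  upper_half_plane z -> nbhs z (@upper_half_plane R).
Proof.
move=> z0; apply/nbhs_normcP; exists (complex.Im z) => // w wz.
have := le_lt_trans (ler_normc_Im _) wz.
by rewrite raddfB ltr_distl subrr /upper_half_plane/= => /andP[].
Qed.

End ComplexTopology.

(** * Local behaviour of a convergent power series *)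

Section PowerSeries.
Context {R : realType}.
Implicit Types (f : R[i]^o -> R[i]^o) (a : nat -> R[i]^o) (z : R[i]^o).

Definition expansion_at a z0 f :=
  \forall z \near z0, series (fun n => a n * (z - z0) ^+ n) @ \oo --> f z.

(** Convergence at one distance [rho] bounds the terms [a n * rho ^+ n], so at
    distance at most [rho / 2] the tail from index [N] on is dominated by a
    geometric series of ratio at most [1 / 2]. *)
Lemma expansion_remainder a z0 f : expansion_at a z0 f ->
  forall N, exists C r : R, [/\ 0 <= C, 0 < r & forall z, normc (z - z0) < r ->
    normc (f z - \sum_(0 <= n < N) a n * (z - z0) ^+ n)
      <= C * normc (z - z0) ^+ N].
Proof.
move=> /nbhs_normcP[s s0 fs] N.
pose rho := s / 2; have rho0 : 0 < rho by rewrite divr_gt0.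
have rhos : rho < s by rewrite /rho ltr_pdivrMr// ltr_pMr// ltrDl.
(* The terms of the convergent series at z0 + rho tend to 0; the finitely many
   terms before they drop below 1 are absorbed in the sum. *)
have [B B0 aB] : exists2 B : R, 0 <= B & forall n, normc (a n) * rho ^+ n <= B.
  have := fs (z0 + rho%:C); rewrite addrC addKr normc_real gtr0_norm// => /(_ rhos).
  move=> /cvgP/cvg_series_cvg_0/cvg_normcP/(_ _ ltr01)[n0 _ n0P].
  exists (1 + \sum_(i < n0) normc (a i) * rho ^+ i).
    rewrite addr_ge0 ?sumr_ge0// => i _.
    by rewrite mulr_ge0 ?normc_ge0 ?exprn_ge0// ltW.
  move=> n; have [nn0|n0n] := ltnP n n0.
    rewrite (bigD1 (Ordinal nn0))//= addrCA lerDl addr_ge0 ?sumr_ge0// => i _.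
    by rewrite mulr_ge0 ?normc_ge0 ?exprn_ge0// ltW.
  apply: ler_wpDr.
    apply: sumr_ge0 => i _.
    by rewrite mulr_ge0 ?normc_ge0 ?exprn_ge0// ltW.
  have := n0P n n0n; rewrite subr0 => /ltW; apply: le_trans.
  rewrite -[X in X ^+ n]gtr0_norm// -normc_real -normcX.
  by rewrite -[leLHS]normcM.
exists (2 * B / rho ^+ N), (rho / 2); split.
- by rewrite !mulr_ge0// invr_ge0 exprn_ge0// ltW.
- by rewrite divr_gt0.
move=> z zrho; set q := normc (z - z0) / rho.
have q0 : 0 <= q by rewrite divr_ge0 ?normc_ge0// ltW.
have q2 : q <= 2^-1 by rewrite /q ler_pdivrMr// mulrC ltW.
have term n : normc (a n * (z - z0) ^+ n) <= B * q ^+ n.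
  rewrite [leLHS]normcM normcX /q expr_div_n mulrA ler_pdivlMr ?exprn_gt0//.
  by rewrite mulrAC ler_wpM2r// exprn_ge0// normc_ge0.
pose S n : R[i]^o := \sum_(0 <= k < n) a k * (z - z0) ^+ k.
(* The bound 2 - 2 (1/2)^j is the sum of the first j terms of the geometric
   series of ratio 1/2. *)
have tail j : normc (S (N + j)%N - S N) <= B * q ^+ N * (2 - 2 * 2^-1 ^+ j).
  elim: j => [|j IH]; first by rewrite addn0 subrr normc0 expr0 mulr1 subrr mulr0.
  rewrite addnS /S big_nat_recr//= -/(S (N + j)%N) addrAC.
  apply: le_trans (ler_normcD _ _) _.
  apply: le_trans (lerD IH (term _)) _.
  have -> : 2 - 2 * 2^-1 ^+ j.+1 = 2 - 2 * 2^-1 ^+ j + 2^-1 ^+ j :> R.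
    by rewrite exprS; lra.
  rewrite [leRHS]mulrDr lerD2l exprD mulrA ler_wpM2l//.
    by rewrite mulr_ge0// exprn_ge0.
  by rewrite lerXn2r// nnegrE.
have -> : 2 * B / rho ^+ N * normc (z - z0) ^+ N = 2 * B * q ^+ N.
  by rewrite /q (expr_div_n (normc _)) [RHS]mulrA [RHS]mulrAC.
apply/ler_addgt0Pr => e e0.
have /fs/cvg_normcP/(_ e e0)[n1 _ n1P] : normc (z - z0) < s.
  by apply: lt_trans zrho _; rewrite (lt_trans _ rhos)// /rho; lra.
have := n1P (N + n1)%N (leq_addl _ _); rewrite /= -/(S (N + n1)%N) => Se.
rewrite -[X in normc X](subrKA (S (N + n1)%N)).
apply: le_trans (ler_normcD _ _) _; rewrite addrC.
rewrite lerD//; last by rewrite -normc_opp opprB ltW.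
apply: le_trans (tail _) _.
rewrite mulrC mulrA ler_wpM2r ?exprn_ge0// ler_wpM2r//.
by rewrite gerBl mulr_ge0// exprn_ge0.
Qed.

Lemma expansion_coef0 a z0 f : expansion_at a z0 f -> f z0 = a 0%N.
Proof.
move=> /expansion_remainder /(_ 1%N) [C [r [_ r0 /(_ z0)]]].
rewrite subrr normc0 => /(_ r0); rewrite big_nat1 expr0 mulr1 expr1 mulr0 => H.
by apply/eqP; rewrite -subr_eq0; apply/eqP/eq0_normc/le_anti; rewrite H normc_ge0.
Qed.

Lemma expansion_continuous a z0 f :
  expansion_at a z0 f -> {for z0, continuous f}.
Proof.
move=> ae; have fa := expansion_coef0 ae.
have [C [r [C0 r0 fC]]] := expansion_remainder ae 1%N.
apply/(@cvg_normcP _ _ (nbhs z0)) => e e0; apply/nbhs_normcP.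
exists (Num.min r (e / (C + 1))).
  by rewrite lt_min r0 divr_gt0// ltr_wpDl.
move=> z; rewrite lt_min => /andP[zr ze]; rewrite fa.
have := fC z zr; rewrite big_nat1 expr0 mulr1 expr1 => /le_lt_trans; apply.
move: ze; rewrite ltr_pdivlMr ?ltr_wpDl// mulrC; apply: le_lt_trans.
by rewrite ler_wpM2r ?normc_ge0// lerDl.
Qed.

(** Local minimum principle.  If the expansion has a first nonconstant term
    [a m * (z - z0) ^+ m], then a small step [t * u] from [z0] with
    [a m * u ^+ m = - 'i] changes the imaginary part by [- t ^+ m] up to
    [O(t ^+ m.+1)] and makes it negative.  Otherwise [f] is constant near [z0]. *)
Lemma expansion_Im_min a z0 f : expansion_at a z0 f ->
  (\forall z \near z0, 0 <= complex.Im (f z)) ->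
  complex.Im (f z0) = 0 -> \forall z \near z0, complex.Im (f z) = 0.
Proof.
move=> ae f_ge0 fz0; have fa := expansion_coef0 ae.
have [am|a_eq0] := pselect (exists n, a n.+1 != 0); last first.
  apply: filterS ae => z fz; rewrite -[RHS]fz0; congr complex.Im.
  rewrite fa; apply: (cvg_unique _ fz).
    exact: norm_hausdorff.
  apply: cvg_near_cst; exists 1%N => // n /= n1.
  rewrite /series/= big_ltn// expr0 mulr1 big_nat_cond big1 ?addr0//.
  move=> [|i]; rewrite ?andbF// => _; have [->|ai] := eqVneq (a i.+1) 0.
    by rewrite mul0r.
  by exfalso; apply: a_eq0; exists i.
have [m am0 m_min] := ex_minnP am.
have aj j : (0 < j <= m)%N -> a j = 0.
  case: j => // j /= jm; apply/eqP; apply: contraTT jm => /m_min.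
  by rewrite -leqNgt.
pose u : R[i]^o := m.+1.-root (- 'i%C / a m.+1).
have um : a m.+1 * u ^+ m.+1 = - 'i%C.
  by rewrite /u rootCK// mulrC divfK.
have u0 : 0 < normc u.
  rewrite lt_neqAle normc_ge0 andbT eq_sym; apply/eqP => /eq0_normc u0.
  by move: um => /eqP; rewrite u0 expr0n/= mulr0 eq_sym oppr_eq0 eq_complex/= oner_eq0 andbF.
(* The index of the first nonconstant term is m.+1, so the remainder after it
   has order m.+2. *)
have [C [r [C0 r0 fC]]] := expansion_remainder ae m.+2.
have /nbhs_normcP[s s0 sP] := f_ge0.
(* The error C (t |u|)^(m+2) is t^(m+1) times t (K - 1), so t K < 1 is what makes
   it smaller than the main term t^(m+1). *)
pose K := C * normc u ^+ m.+2 + 1.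
have K0 : 0 < K by rewrite ltr_wpDl// mulr_ge0// exprn_ge0// normc_ge0.
pose t := Num.min (Num.min r s / normc u) K^-1 / 2.
have t0 : 0 < t by rewrite divr_gt0// !lt_min invr_gt0 K0 andbT divr_gt0// lt_min r0.
have tlt x : t * 2 <= x -> 0 < x -> t < x by lra.
have /andP[tr ts] : (t * normc u < r) && (t * normc u < s).
  rewrite -lt_min -ltr_pdivlMr//; apply: tlt; last first.
    by rewrite divr_gt0// lt_min r0.
  by rewrite /t divfK// ge_min lexx.
have tK : t * K < 1.
  rewrite -ltr_pdivlMr// mul1r; apply: tlt; last by rewrite invr_gt0.
  by rewrite /t divfK// ge_min lexx orbT.
pose z : R[i]^o := z0 + t%:C * u.
have zz0 : z - z0 = t%:C * u by rewrite /z addrC addKr.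
have nz : normc (z - z0) = t * normc u.
  by rewrite zz0 [LHS]normcM normc_real gtr0_norm.
have := fC z; have := sP z; rewrite nz => /(_ ts) fz_ge0 /(_ tr).
have -> : \sum_(0 <= n < m.+2) a n * (z - z0) ^+ n = a 0%N - (t ^+ m.+1)%:C * 'i%C.
  rewrite big_nat_recr//= big_ltn// expr0 mulr1 big_nat_cond big1 ?addr0; last first.
    by move=> j /andP[/aj -> _]; rewrite mul0r.
  by rewrite zz0 exprMn mulrCA um mulrN rmorphXn.
move=> /(le_trans (ler_normc_Im _)).
rewrite raddfB/= raddfB/= -fa fz0 /= !mul0r mulr1 addr0 sub0r opprK.
rewrite gtr0_norm ?ltr_wpDl ?exprn_gt0//.
have -> : C * (t * normc u) ^+ m.+2 = t ^+ m.+1 * (t * (K - 1)).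
  by rewrite /K exprMn [in LHS]exprSr; ring.
move=> H; exfalso.
have : t ^+ m.+1 <= t ^+ m.+1 * (t * (K - 1)) by apply: le_trans H; rewrite lerDr.
by rewrite leNgt gtr_pMr ?exprn_gt0// mulrBr mulr1 ltrBlDr (lt_trans tK)// ltrDl.
Qed.

End PowerSeries.

(** * The strong minimum principle on the upper half plane *)

Section StrongMinimum.
Context {R : realType}.
Implicit Types (f : R[i]^o -> R[i]^o) (z : R[i]^o).

Lemma analytic_continuous f (D : set R[i]^o) z :
  analytic_on D f -> D z -> {for z, continuous f}.
Proof. by move=> fD /fD[a]; exact: expansion_continuous. Qed.

Lemma analytic_Im_continuous f (D : set R[i]^o) z :
  analytic_on D f -> D z -> {for z, continuous (fun z => complex.Im (f z) : R)}.
Proof.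
move=> fD Dz; apply: continuous_comp; first exact: analytic_continuous fD Dz.
exact: continuous_Im.
Qed.

(** The zero set of [Im f] is closed by continuity and open by the local minimum
    principle.  Pulling it back along a path from [z0] to [z1] reduces the claim
    to the connectedness of the real line. *)
Lemma Im_eq0_propagates f z0 z1 :
  analytic_on upper_half_plane f ->
  (forall z, upper_half_plane z -> 0 <= complex.Im (f z)) ->
  upper_half_plane z0 -> upper_half_plane z1 ->
  complex.Im (f z0) = 0 -> complex.Im (f z1) = 0.
Proof.
move=> fA f_ge0 z0P z1P fz0.
(* The path is a segment in the coordinates (Re z, ln (Im z)), so that it stays
   in the half plane for every real parameter. *)
pose line (a b t : R) : R := a + t * (b - a).
pose path t : R[i]^o := (line (complex.Re z0) (complex.Re z1) t
  +i* expR (line (ln (complex.Im z0)) (ln (complex.Im z1)) t))%C.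
have line_cont a b : continuous (line a b).
  by move=> t; apply: cvgD; [exact: cvg_cst|apply: cvgM; [exact: cvg_id|exact: cvg_cst]].
have path_cont : continuous path.
  move=> t; apply: continuous_complex; first exact: line_cont.
  by apply: continuous_comp; [exact: line_cont|exact: continuous_expR].
have pathP t : upper_half_plane (path t) by exact: expR_gt0.
pose Z : set R := [set t | complex.Im (f (path t)) = 0].
have path0 : path 0 = z0.
  rewrite /path /line !mul0r !addr0 lnK ?posrE//.
  by case: (z0).
have path1 : path 1 = z1.
  rewrite /path /line !mul1r !subrKC lnK ?posrE//.
  by case: (z1).
have Z_open : open Z.
  rewrite openE => t Zt; apply: (path_cont t [set z | complex.Im (f z) = 0]).
  have [a fa] := fA _ (pathP t).
  apply: expansion_Im_min fa _ Zt.
  by apply: filterS (nbhs_upper_half_plane (pathP t)) => z; exact: f_ge0.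
have Z_closed : closed Z.
  rewrite (_ : Z = (fun t => complex.Im (f (path t))) @^-1` [set x : R | x = 0])//.
  apply: preimage_closed; last exact: closed_eq.
  move=> t _; apply: (@continuous_comp _ (R[i]^o) _ path
    (fun z => complex.Im (f z)) t (path_cont t)).
  exact: analytic_Im_continuous fA (pathP t).
have R_connected : connected [set: R] by apply/connected_intervalP.
have ZT : Z = setT.
  apply: R_connected.
  - by exists 0; rewrite /Z/= path0.
  - by exists Z => //; rewrite setTI.
  - by exists Z => //; rewrite setTI.
by have : Z 1 by [rewrite ZT]; rewrite /Z/= path1.
Qed.

Lemma Im_gt0_of_nt_limit_pinfty f tau z :
  analytic_on upper_half_plane f ->
  (forall z, upper_half_plane z -> 0 <= complex.Im (f z)) ->
  nt_limit (fun z => (frakF (fun=> 1) f z)%:E) tau +oo%E ->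
  upper_half_plane z -> 0 < complex.Im (f z).
Proof.
move=> fA f_ge0 foo zP; rewrite lt_neqAle f_ge0// andbT eq_sym; apply/eqP => fz.
have /cvgeyPge/(_ 1)/nbhs_normcP[d d0 fd] := foo 1 ltr01 (lexx _).
have d2 : 0 < d / 2 by rewrite divr_gt0.
pose w : R[i]^o := (tau +i* (d / 2))%C.
have wdist : normc (w - tau%:C) = d / 2.
  by rewrite /= subrr subr0 expr0n add0r sqrtr_sqr gtr0_norm.
have : 1 <= complex.Im (f w).
  have := fd w; rewrite wdist /frakF divr1 lee_fin; apply; first by lra.
  split; first exact: d2.
  by rewrite mul1r -[leLHS]/((normc (w - tau%:C))%:C) wdist.
by rewrite (Im_eq0_propagates fA f_ge0 zP _ fz)// ler10.
Qed.

End StrongMinimum.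

(** * Averages along a nontangential region *)

Section Gauge.
Context {R : realType}.
Implicit Types (h : R[i]^o -> R) (tau : R) (k lambda : R -> R).

(** The aperture [c / (c + 1)] comes from
    [|z - tau| <= |x| + y <= (1 / c + 1) * y] on the slice. *)
Lemma nt_region_slice (c tau x y : R) : 0 < c -> 0 < y -> `|x| <= y / c ->
  nt_region (c / (c + 1)) tau ((tau + x) +i* y)%C /\
  normc (((tau + x) +i* y)%C - tau%:C) <= y / (c / (c + 1)).
Proof.
move=> c0 y0 xy.
have c1 : 0 < c + 1 by rewrite addr_gt0.
have le_dist : normc (((tau + x) +i* y)%C - tau%:C) <= y / (c / (c + 1)).
  apply: le_trans (normc_le_ReIm _) _.
  rewrite /= subr0 (addrC tau) addrK (gtr0_norm y0).
  have -> : y / (c / (c + 1)) = y / c + y.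
    by field; rewrite !gt_eqF.
  by rewrite lerD2r.
split=> //; split; first exact: y0.
have M0 : 0 < c / (c + 1) by rewrite divr_gt0.
have : c / (c + 1) * normc (((tau + x) +i* y)%C - tau%:C) <= y.
  by rewrite mulrC -ler_pdivlMr.
rewrite -lecR rmorphM; exact.
Qed.

(** The gauge is the maximum of [h] over the slice [|x| <= y / c] at height [y],
    plus [y] to make it positive. *)
Lemma exists_gauge h tau lambda :
  (forall z, upper_half_plane z -> {for z, continuous h}) ->
  (forall z, upper_half_plane z -> 0 <= h z) ->
  nt_limit h tau (0 : R) ->
  (forall t, 0 < t -> 0 < lambda t) -> is_Omega_id lambda ->
  exists k : R -> R, [/\ forall t, 0 < t -> 0 < k t, k @ 0^'+ --> (0 : R) &
    (limf_esup (fun eps : R => (((2 * eps)^-1)%:E *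
      \int[lebesgue_measure]_(x in `[(- eps)%R, eps])
        (h ((tau + x)%R +i* lambda eps)%C / k (lambda eps))%:E)%E) 0^'+ < +oo)%E].
Proof.
move=> h_cont h_ge0 h_lim lambda_pos [c [delta [c0 delta0 lambda_gt]]].
have slice_cont y : 0 < y -> continuous (fun x : R => h ((tau + x) +i* y)%C).
  move=> y0 x; apply: (@continuous_comp _ (R[i]^o) _
    (fun x => ((tau + x) +i* y)%C : R[i]^o) h); last exact: h_cont.
  apply: continuous_complex; last exact: cvg_cst.
  by apply: cvgD; [exact: cvg_cst|exact: cvg_id].
have /choice[m mP] : forall y, exists m : R, 0 < y ->
    (exists2 x, `|x| <= y / c & m = h ((tau + x) +i* y)%C) /\
    (forall x, `|x| <= y / c -> h ((tau + x) +i* y)%C <= m).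
  move=> y; have [y0|] := ltP 0 y; last by exists 0.
  have yc : - (y / c) <= y / c by rewrite ge0_cp// divr_ge0// ltW.
  have [x xin xmax] := EVT_max yc
    (continuous_subspaceT (slice_cont y y0)).
  exists (h ((tau + x) +i* y)%C) => _; split.
    by exists x => //; move: xin; rewrite in_itv/= ler_norml.
  by move=> t ty; apply: xmax; rewrite in_itv/= -ler_norml.
have m_ge0 y : 0 < y -> 0 <= m y.
  by move=> y0; have [[x _ ->] _] := mP y y0; exact: h_ge0.
pose k y := m y + y.
have k_gt0 y : 0 < y -> 0 < k y by move=> y0; rewrite ltr_wpDl// m_ge0.
exists k; split => //.
- have M0 : 0 < c / (c + 1) by rewrite divr_gt0// addr_gt0.
  have M1 : c / (c + 1) <= 1 by rewrite ler_pdivrMr ?addr_gt0// mul1r lerDl.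
  apply/cvgrPdistC_lt => e e0.
  have e2 : 0 < e / 2 by rewrite divr_gt0.
  have /cvgrPdistC_lt/(_ _ e2) := h_lim _ M0 M1.
  move=> /nbhs_normcP[d d0 hd].
  near=> y; have y0 : 0 < y by near: y; exact: nbhs_right_gt.
  rewrite subr0 gtr0_norm ?k_gt0// [e]splitr; apply: ltrD; last first.
    by near: y; exact: nbhs_right_lt.
  have [[x xy ->] _] := mP y y0.
  have [xM xd] := nt_region_slice tau c0 y0 xy.
  apply: le_lt_trans (ler_norm _) _; rewrite -[X in `|X|]subr0.
  apply: hd => //; apply: le_lt_trans xd _; rewrite ltr_pdivrMr//.
  by near: y; apply: nbhs_right_lt; rewrite mulr_gt0.
- apply: (@le_lt_trans _ _ 1%E); last exact: ltry.
  apply: ereal_inf_le; eexists.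
    exists [set e | 0 < e < delta]; last reflexivity.
    near=> e; apply/andP; split; near: e; first exact: nbhs_right_gt.
    exact: nbhs_right_lt.
  apply: ge_ereal_sup => _ [e /andP[e0 ed] <-].
  have le0 := lambda_pos e e0.
  (* 1 is its own average, which reduces the bound to the integrands. *)
  have -> : (1 = ((2 * e)^-1)%:E *
      \int[lebesgue_measure]_(x in `[(- e)%R, e]) (cst 1 x) :> \bar R)%E.
    rewrite integral_cst// mul1e /= lebesgue_measure_itv/= lte_fin gt0_cp//.
    rewrite -EFinD -EFinM opprK -mulr2n -(mulr_natl e) mulVf//.
    by rewrite gt_eqF// mulr_gt0.
  apply: lee_wpmul2l; first by rewrite lee_fin invr_ge0 mulr_ge0// ltW.
  apply: ge0_le_integral => //.
  + move=> x _; rewrite lee_fin divr_ge0//; last exact/ltW/k_gt0.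
    exact: h_ge0.
  + apply/measurable_EFinP; apply: measurable_funTS.
    apply: continuous_measurable_fun => x.
    by apply: cvgM; [exact: slice_cont|exact: cvg_cst].
  + move=> x /=; rewrite in_itv/= -ler_norml => xe.
    rewrite lee_fin ler_pdivrMr ?k_gt0// mul1r /k.
    have [_ mx] := mP _ le0.
    apply: (@le_trans _ _ (m (lambda e))); last by rewrite lerDl ltW.
    apply: mx; apply: le_trans xe _; rewrite ler_pdivlMr// mulrC ltW//.
    by apply: lambda_gt; rewrite e0.
Unshelve. all: by end_near.
Qed.

End Gauge.

(** * The two cases of the theorem *)

Lemma Im_neg_inv (R : rcfType) (w : R[i]) : complex.Im (- 1 / w) =
  complex.Im w / (complex.Re w ^+ 2 + complex.Im w ^+ 2).
Proof.
by rewrite mulN1r raddfN/=; case: w => a b /=; rewrite opprK.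
Qed.

Lemma Im_neg_inv_le (R : rcfType) (w : R[i]) :
  0 < complex.Im w -> complex.Im (- 1 / w) <= (complex.Im w)^-1.
Proof.
move=> w0; have w20 : 0 < complex.Im w ^+ 2 by rewrite exprn_gt0.
rewrite Im_neg_inv ler_pdivrMr; last by rewrite ltr_wpDl ?sqr_ge0.
rewrite mulrC ler_pdivlMr// -expr2 lerDr; exact: sqr_ge0.
Qed.

Theorem theorem2p8 (R : realType) (f : R[i]^o -> R[i]^o) (tau : R)
    (lambda : R -> R)
    (f_analytic : analytic_on upper_half_plane f)
    (f_maps : forall z : R[i]^o, upper_half_plane z -> 0 <= complex.Im (f z))
    (tau_crypto : cryptospectrum f tau)
    (lambda_pos : forall t, 0 < t -> 0 < lambda t)
    (lambda_Omega : is_Omega_id lambda) :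
  exists k : R -> R,
    [/\ forall t, 0 < t -> 0 < k t,
        k @ 0^'+ --> (0 : R) &
        enigma k f lambda tau].
Proof.
have Im_cont z : upper_half_plane z ->
    {for z, continuous (fun z : R[i]^o => complex.Im (f z) : R)}.
  exact: analytic_Im_continuous f_analytic.
case: tau_crypto => -[f0|foo] _ _.
- have [|k [k0 kcvg klim]] :=
      exists_gauge Im_cont f_maps _ lambda_pos lambda_Omega (tau := tau).
    move=> M M0 M1; have /fine_cvgP[_] := f0 M M0 M1.
    by under eq_cvg do rewrite /= /frakF divr1.
  by exists k; split => //; left.
- have f_pos z := Im_gt0_of_nt_limit_pinfty f_analytic f_maps foo (z := z).
  pose h (z : R[i]^o) : R := complex.Im (- 1 / f z).
  have den_gt0 z : upper_half_plane z ->
      0 < complex.Re (f z) ^+ 2 + complex.Im (f z) ^+ 2.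
    by move=> /f_pos fz; rewrite ltr_wpDl ?sqr_ge0// exprn_gt0.
  have h_ge0 z : upper_half_plane z -> 0 <= h z.
    by move=> zP; rewrite /h Im_neg_inv divr_ge0 ?f_maps// ltW// den_gt0.
  have h_cont z : upper_half_plane z -> {for z, continuous h}.
    move=> zP.
    rewrite (_ : h = fun z => complex.Im (f z) /
      (complex.Re (f z) * complex.Re (f z) +
       complex.Im (f z) * complex.Im (f z))); last first.
      by apply/funext => x; rewrite /h Im_neg_inv !expr2.
    have Re_cont : {for z, continuous (fun z : R[i]^o => complex.Re (f z) : R)}.
      apply: continuous_comp (analytic_continuous f_analytic zP) _.
      exact: continuous_Re.
    have Im_cont_z := Im_cont z zP.
    apply: (@cvgM R _ (nbhs z)); first exact: Im_cont_z.
    apply: (@cvgV R _ (nbhs z)); first by rewrite -!expr2 gt_eqF// den_gt0.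
    by apply: (@cvgD _ R _ (nbhs z)); apply: (@cvgM R _ (nbhs z)).
  have [|k [k0 kcvg klim]] :=
      exists_gauge h_cont h_ge0 _ lambda_pos lambda_Omega (tau := tau).
    move=> M M0 M1; apply/cvgrPdistC_le => e e0.
    have zR : \forall z \near within (nt_region M tau) (nbhs (tau%:C : R[i]^o)),
      nt_region M tau z by exact: withinT.
    have /cvgeyPge/(_ e^-1) := foo M M0 M1.
    apply: filterS2 zR => z [zP _].
    rewrite /frakF divr1 lee_fin => fz; rewrite subr0 ger0_norm ?h_ge0//.
    apply: le_trans (Im_neg_inv_le (f_pos z zP)) _.
    by rewrite invf_ple ?posrE ?f_pos.
  by exists k; split => //; right.
Qed.
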